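(* A class of Cayley permutations with only finitely many simple members has a finite basis.
   Context: Write $[n]=\{1,\ldots,n\}$. A Cayley permutation of length $n$ is a word $\omega=w_1\cdots w_n$ of positive integers whose set of letters is $[m]$ for some $m\leq n$ (the empty word is allowed for $n=0$); equivalently a map $\omega:[n]\to[n]$, $\omega(i)=w_i$, with image $[m]$. $\mathrm{Cay}$ is the set of all Cayley permutations. A nonempty interval of positions $I=[a,b]\subseteq[n]$ is an H-interval of a Cayley permutation $\omega$ of length $n$ if there is an interval of values $J=[c,d]$ with $\omega(I)=J$ and $\omega^{-1}(J)=I$. $\omega$ is simple if every H-interval of $\omega$ is a singleton or equals $[n]$. The standardization $\mathrm{st}(w)$ of a word $w$ replaces its smallest letter by $1$, the next smallest by $2$, and so on, keeping repetitions equal. For Cayley permutations $\tau,\omega$, write $\tau\leq\omega$ if $\omega$ has a (not necessarily contiguous) subsequence $\alpha$ with $\mathrm{st}(\alpha)=\tau$. A class of Cayley permutations is a subset $\mathcal{C}\subseteq\mathrm{Cay}$ that is an order ideal: $\tau\leq\omega\in\mathcal{C}$ implies $\tau\in\mathcal{C}$. The basis of $\mathcal{C}$ is the set of $\leq$-minimal Cayley permutations not in $\mathcal{C}$. *)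

(* Defs.v *)
From mathcomp Require Import all_boot.
From mathcomp Require Import boolp classical_sets cardinality.

Set Implicit Arguments.
Unset Strict Implicit.
Unset Printing Implicit Defensive.

Local Open Scope classical_set_scope.

(* A word w_1 ... w_n is a [seq nat]; its positions are numbered from 0, so    *)
(* that the letter at position [i < size w] is [nth 0 w i].                   *)
Definition cayley : set (seq nat) :=
  [set w | exists2 m, m <= size w & forall x, (x \in w) = (1 <= x <= m)].

Definition nat_itv (a b : nat) : set nat := [set i | a <= i <= b].

Definition H_interval (w : seq nat) (a b : nat) : Prop :=
  a <= b < size w /\
  exists c d : nat,
    nth 0 w @` nat_itv a b = nat_itv c d /\
    [set i | i < size w /\ nat_itv c d (nth 0 w i)] = nat_itv a b.

Definition simple : set (seq nat) :=
  [set w | cayley w /\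
    forall a b, H_interval w a b -> a = b \/ (a = 0 /\ b.+1 = size w)].

(* A letter x is sent to its rank, i.e. one plus the number of distinct       *)
(* letters of w that are smaller than x.                                      *)
Definition standardization (w : seq nat) : seq nat :=
  [seq (count (fun y => y < x) (undup w)).+1 | x <- w].

Definition pattern_le (t w : seq nat) : Prop :=
  exists2 s, subseq s w & standardization s = t.

Definition cayley_class (C : set (seq nat)) : Prop :=
  C `<=` cayley /\
  forall t w, cayley t -> pattern_le t w -> C w -> C t.

Definition basis (C : set (seq nat)) : set (seq nat) :=
  [set w | [/\ cayley w, ~ C w &
    forall t, cayley t -> ~ C t -> pattern_le t w -> t = w]].

(* Main.v *)
Require Import Defs.
From mathcomp Require Import all_boot.
From mathcomp Require Import boolp classical_sets cardinality.
From mathcomp Require Import functions zify.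

(* Suppose that the basis of C is infinite. Delete the first letter a of each *)
(* basis element a w and label every letter of w by how it compares with a;   *)
(* it suffices that one of these labelled words embeds in another one,        *)
(* preserving labels. View a word as a set of points, where the colour of a   *)
(* pair of points records how their positions and their letters compare, and  *)
(* call a set primitive if its only modules (subsets whose points are not     *)
(* distinguished by the colours to any outside point) are trivial. An         *)
(* H-interval is a module, so a primitive subset of w yields a simple pattern *)
(* of w, which lies in C by minimality of a w: the primitive subsets have     *)
(* bounded size. Partition w into at least two modules, as few as possible:   *)
(* representatives of the blocks form a primitive set, so there are boundedly *)
(* many blocks, and w is determined by them and by finitely much data. The    *)
(* labelled words are therefore well-quasi-ordered by Higman's theorem.       *)

Set Implicit Arguments.
Unset Strict Implicit.
Unset Printing Implicit Defensive.

Local Open Scope classical_set_scope.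

(** Distinct basis elements are incomparable, so an infinite basis is excluded once any sequence of
    basis elements has a term below a later one. Two facts meet in [wqo_primitives_bounded]:
    [exists_primitive_quotient] splits a set into modules whose representatives form a primitive
    set, hence into boundedly many, and [wqo_on_generated] handles such recursive decompositions by
    Nash-Williams' minimal bad sequence argument. The bound comes from [primitive_simple] and
    [basis_primitives_bounded]; [embeds_pattern_le] turns an embedding back into a pattern. *)

(** * Well-quasi-orders and minimal bad sequences *)

Definition wqo_on (X : Type) (R : X -> X -> Prop) (A : X -> Prop) : Prop :=
  forall f : nat -> X, (forall i, A (f i)) ->
    exists i j, i < j /\ R (f i) (f j).

Definition bad (X : Type) (R : X -> X -> Prop) (f : nat -> X) : Prop :=
  forall i j, i < j -> ~ R (f i) (f j).

Lemma wqo_on_eq (K : finType) : wqo_on (@eq K) (fun=> True).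
Proof.
move=> f _; apply: contrapT => H.
pose g (i : 'I_#|K|.+1) := f i.
have /leq_card : injective g.
  move=> i j; rewrite /g => eq_f; apply: val_inj; apply: contrapT => /eqP.
  by rewrite neq_ltn => /orP[] lt; apply: H;
    [exists (val i), (val j) | exists (val j), (val i)].
by rewrite card_ord ltnn.
Qed.

Lemma homo_ltn_iter (h : nat -> nat) (N : nat) :
  (forall i, N <= i -> i < h i) ->
  {homo (fun n => iter n h N) : i j / i < j} /\ forall n, N <= iter n h N.
Proof.
move=> hlt; have Nle n : N <= iter n h N.
  by elim: n => //= n IH; apply: leq_trans IH (ltnW (hlt _ IH)).
by split=> //; apply: homo_ltn => [y x z|n]; [apply: ltn_trans | apply: hlt].
Qed.

(* Only finitely many indices can fail to have a successor in the sequence,   *)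
(* as these would form a bad subsequence.                                     *)
Lemma wqo_on_monotone_subseq (X : Type) (R : X -> X -> Prop) (A : X -> Prop)
    (f : nat -> X) :
  (forall y x z, R x y -> R y z -> R x z) ->
  wqo_on R A -> (forall i, A (f i)) ->
  exists phi : nat -> nat, {homo phi : i j / i < j} /\
    forall i j, i < j -> R (f (phi i)) (f (phi j)).
Proof.
move=> Rtr wA fA.
have [N HN] : exists N, forall i, N <= i -> exists j, i < j /\ R (f i) (f j).
  apply: contrapT => noN.
  have [g Hg] : {g & forall n,
      n < g n /\ forall j, g n < j -> ~ R (f (g n)) (f j)}.
    apply: (choice (P := fun n i => n < i /\ forall j, i < j -> ~ R (f i) (f j))).
    move=> n; apply: contrapT => noi; apply: noN.
    exists n.+1 => i lt_ni; apply: contrapT => noj; apply: noi.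
    by exists i; split=> // j lt_ij Rij; apply: noj; exists j.
  have [phi_lt _] := @homo_ltn_iter g 0 (fun i _ => (Hg i).1).
  have [i [j [lt_ij]]] := wA (fun n => f (iter n.+1 g 0)) (fun=> fA _).
  by apply: (Hg _).2; apply: (phi_lt i.+1 j.+1).
have [h Hh] : {h & forall i, N <= i -> i < h i /\ R (f i) (f (h i))}.
  apply: (choice (P := fun i j => N <= i -> i < j /\ R (f i) (f j))) => i.
  have [/HN[j Hj]|_] := leqP N i; first by exists j.
  by exists 0.
have [phi_lt phi_ge] := @homo_ltn_iter h N (fun i Ni => (Hh i Ni).1).
exists (fun n => iter n h N); split=> //.
by apply: homo_ltn => [y x z|n]; [apply: Rtr | apply: (Hh _ (phi_ge n)).2].
Qed.

Lemma wqo_on_monotone_subseq_family (X : Type) (R : X -> X -> Prop)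
    (A : X -> Prop) (F : nat -> nat -> X) (m : nat) :
  (forall y x z, R x y -> R y z -> R x z) ->
  wqo_on R A -> (forall i k, k < m -> A (F i k)) ->
  exists phi : nat -> nat, {homo phi : i j / i < j} /\
    forall i j k, i < j -> k < m -> R (F (phi i) k) (F (phi j) k).
Proof.
move=> Rtr wA; elim: m => [|m IH] FA; first by exists id; split.
have [i k lt_km|phi [phi_lt Rphi]] := IH; first exact/FA/ltnW.
have [i|psi [psi_lt Rpsi]] :=
  @wqo_on_monotone_subseq _ R A (fun i => F (phi i) m) Rtr wA; first exact: FA.
exists (phi \o psi); split=> [i j lt_ij|i j k lt_ij]; first exact/phi_lt/psi_lt.
rewrite ltnS leq_eqVlt => /predU1P[->|lt_km]; first exact: Rpsi.
exact/Rphi/lt_km/psi_lt.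
Qed.

(** Greedy choice: [next (g, n)] keeps the first [n] terms of [g] and makes the next one as small as
    a bad sequence allows. Earlier terms never change again, so the diagonal of the iterates is the
    sequence sought. *)
Lemma minimal_bad_sequence (X : Type) (R : X -> X -> Prop) (P : X -> Prop)
    (sz : X -> nat) (f0 : nat -> X) :
  (forall i, P (f0 i)) -> bad R f0 ->
  exists f, [/\ forall i, P (f i), bad R f &
    forall g n, (forall i, P (g i)) -> bad R g -> (forall i, i < n -> g i = f i) ->
      sz (f n) <= sz (g n)].
Proof.
move=> Pf0 badf0.
pose ok g := (forall i, P (g i)) /\ bad R g.
have [next Hnext] : {next : (nat -> X) * nat -> nat -> X & forall gn, ok gn.1 ->
    [/\ ok (next gn), forall i, i < gn.2 -> next gn i = gn.1 i &
     forall h, ok h -> (forall i, i < gn.2 -> h i = gn.1 i) ->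
       sz (next gn gn.2) <= sz (h gn.2)]}.
  apply: (choice (P := fun (gn : (nat -> X) * nat) g' => ok gn.1 ->
    [/\ ok g', forall i, i < gn.2 -> g' i = gn.1 i &
     forall h, ok h -> (forall i, i < gn.2 -> h i = gn.1 i) ->
       sz (g' gn.2) <= sz (h gn.2)])) => -[g n] /=.
  have [okg|nokg] := pselect (ok g); last by exists g.
  pose Q k := `[< exists h, [/\ ok h, forall i, i < n -> h i = g i & sz (h n) = k] >].
  have exQ : exists k, Q k by exists (sz (g n)); apply/asboolP; exists g.
  case: (ex_minnP exQ) => k /asboolP[h [okh hg hk]] mink; exists h => _; split=> //.
  move=> h' okh' h'g; rewrite hk; apply: mink; apply/asboolP.
  by exists h'.
pose G := fix G n := if n is n'.+1 then next (G n', n') else f0.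
have okG n : ok (G n) by elim: n => //= n IH; have [] := Hnext (_, n) IH.
have GS n i : i < n -> G n.+1 i = G n i.
  by move=> lt_in; have [_ + _] := Hnext (_, n) (okG n); apply.
have Gagree n i : i < n -> G n i = G i.+1 i.
  by elim: n => // n IH; rewrite ltnS leq_eqVlt => /predU1P[->//|lt_in];
    rewrite GS // IH.
exists (fun n => G n.+1 n); split=> [i|i j lt_ij|g n Pg badg gG].
- by have [+ _] := okG i.+1.
- rewrite -(@Gagree j.+1 i); last exact: ltnW.
  by have [_ +] := okG j.+1; apply.
- have [_ _ /(_ g (conj Pg badg))] := Hnext (_, n) (okG n); apply=> i lt_in /=.
  by rewrite gG // -(Gagree n).
Qed.

(* Higman's theorem, with an element [s] built from the constituents [B k],   *)
(* [k < M], by the operation [key], whenever [D s key B] holds.               *)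
Theorem wqo_on_generated (X : Type) (R : X -> X -> Prop) (P : X -> Prop)
    (sz : X -> nat) (K : finType) (M : nat)
    (D : X -> K -> (nat -> X) -> Prop) :
  (forall y x z, R x y -> R y z -> R x z) ->
  (forall s t, sz s = 0 -> R s t) ->
  (forall s, P s -> 0 < sz s -> exists key B, D s key B) ->
  (forall s key B k, P s -> D s key B -> k < M ->
    [/\ P (B k), sz (B k) < sz s & R (B k) s]) ->
  (forall s t key B B', D s key B -> D t key B' ->
    (forall k, k < M -> R (B k) (B' k)) -> R s t) ->
  wqo_on R P.
Proof.
move=> Rtr R0 Ddec Dsub Dop f0 Pf0; apply: contrapT => nogood.
have badf0 : bad R f0 by move=> i j lt_ij Rij; apply: nogood; exists i, j.
have [f [Pf badf minf]] := minimal_bad_sequence sz Pf0 badf0.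
have fgt0 i : 0 < sz (f i).
  rewrite lt0n; apply/eqP => sz0.
  exact: (badf i i.+1 (ltnSn i)) (R0 _ _ sz0).
have [key Hkey] := choice (fun i => Ddec _ (Pf i) (fgt0 i)).
have [B HB] := choice Hkey.
(* A bad sequence [g] of constituents could be spliced into [f] at the least index [N] that supplies
   one of them. The result [h] stays bad, since each constituent lies below its parent, but its term
   at [N] is too small. *)
have wB : wqo_on R (fun x => exists i k, k < M /\ x = B i k).
  move=> g gB; apply: contrapT => nogood_g.
  have [idx Hidx] := choice gB.
  pose Q n := `[< exists k, idx k = n >].
  have exQ : exists n, Q n by exists (idx 0); apply/asboolP; exists 0.
  case: (ex_minnP exQ) => N /asboolP[k0 idxk0] minN.
  pose h i := if i < N then f i else g (k0 + (i - N)).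
  have gsub k : [/\ P (g k), sz (g k) < sz (f (idx k)) & R (g k) (f (idx k))].
    by have [k' [lt_k' ->]] := Hidx k; apply: Dsub (HB _) lt_k'.
  have Nle k : N <= idx k by apply: minN; apply/asboolP; exists k.
  have Ph i : P (h i) by rewrite /h; case: ifP => // _; have [] := gsub (k0 + (i - N)).
  have badh : bad R h.
    move=> i j lt_ij; rewrite /h; case: (ltnP j N) => [lt_jN|le_Nj].
      by rewrite (ltn_trans lt_ij lt_jN); apply: badf.
    case: ltnP => [lt_iN|le_Ni] Rij; last first.
      by apply: nogood_g; exists (k0 + (i - N)), (k0 + (j - N)); split=> //; lia.
    have [_ _ Rg] := gsub (k0 + (j - N)).
    by apply: badf (Rtr _ _ _ Rij Rg); apply: leq_trans lt_iN (Nle _).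
  have : sz (f N) <= sz (h N) by apply: minf => // i lt_iN; rewrite /h lt_iN.
  by have [_ + _] := gsub k0; rewrite idxk0 /h ltnn subnn addn0 ltnNge => /negP.
(* Along a subsequence all [M] constituents increase; two of its keys agree by the pigeonhole
   principle. *)
have [phi [phi_lt Rphi]] := wqo_on_monotone_subseq_family (F := B) (m := M) Rtr wB
  (fun i k lt_kM => ex_intro _ i (ex_intro _ k (conj lt_kM erefl))).
have [i [j [lt_ij eq_key]]] := @wqo_on_eq K (key \o phi) (fun=> I).
apply: (badf _ _ (phi_lt _ _ lt_ij)).
apply: (Dop _ _ _ _ _ (HB (phi i))); last by move=> k; apply: Rphi lt_ij.
by rewrite /= in eq_key; rewrite eq_key; apply: HB.
Qed.

(** * Modules and primitive quotients *)

Definition color_module (T : eqType) (K : Type) (c : T -> T -> K) (X : seq T)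
    (M : pred T) : Prop :=
  {in X & &, forall x y z, M x -> M y -> ~~ M z -> c z x = c z y}.

Definition primitive (T : eqType) (K : Type) (c : T -> T -> K) (X : seq T) : Prop :=
  forall M : pred T, color_module c X M ->
    {in X &, forall x y, M x -> M y -> x = y} \/ {in X, forall x, M x}.

(* [b] sends each point to a chosen representative of its block. *)
Definition module_partition (T : eqType) (K : Type) (c : T -> T -> K) (s : seq T)
    (b : T -> T) : Prop :=
  [/\ {in s, forall x, b x \in s}, {in s, forall x, b (b x) = b x} &
      {in s & &, forall x y z, b x = b y -> b z != b x -> c z x = c z y}].

Lemma module_partition_color (T : eqType) (K : Type) (c : T -> T -> K)
    (s : seq T) (b : T -> T) :
  (forall x y x' y', c x y = c x' y' -> c y x = c y' x') ->
  module_partition c s b ->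
  {in s &, forall x y, b x != b y -> c x y = c (b x) (b y)}.
Proof.
move=> csym [bs bK bmod] x y xs ys bxy.
rewrite (bmod y (b y) x) ?bs ?bK //; apply: csym.
by apply: bmod; rewrite ?bs ?bK // eq_sym.
Qed.

(* Take a partition with as few blocks as possible: a nontrivial module of    *)
(* representatives would allow to merge some of its blocks.                   *)
Lemma exists_primitive_quotient (T : eqType) (K : Type) (c : T -> T -> K)
    (s : seq T) :
  (forall x y x' y', c x y = c x' y' -> c y x = c y' x') ->
  uniq s -> 1 < size s ->
  exists b, [/\ module_partition c s b, 1 < size (undup (map b s)) &
                primitive c (undup (map b s))].
Proof.
move=> csym us s_gt1.
pose Q n := `[< exists b, [/\ module_partition c s b,
  1 < size (undup (map b s)) & size (undup (map b s)) = n] >].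
have exQ : exists n, Q n.
  exists (size s); apply/asboolP; exists id.
  rewrite map_id undup_id //; split=> //.
  by split=> // x y z _ _ _ ->.
case: (ex_minnP exQ) => n /asboolP[b [part_b b_gt1 b_n]] min_n.
exists b; split=> // M modM.
have [bs bK bmod] := part_b; have bcolor := module_partition_color csym part_b.
set X := undup (map b s) in b_gt1 b_n modM *.
have bX x : x \in s -> b x \in X by move=> xs; rewrite mem_undup map_f.
have XP x : x \in X -> x \in s /\ b x = x.
  by rewrite mem_undup => /mapP[u us' ->]; rewrite bs ?bK.
apply: contrapT => /not_orP[notsub notall].
have [x [y [xX yX Mx My xy]]] : exists x y, [/\ x \in X, y \in X, M x, M y & x != y].
  apply: contrapT => H; apply: notsub => x y xX yX Mx My; apply: contrapT => /eqP xy.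
  by apply: H; exists x, y.
have [z zX Mz] : exists2 z, z \in X & ~~ M z.
  apply: contrapT => H; apply: notall => z zX; apply: contrapT => /negP Mz.
  by apply: H; exists z.
have [xs bx] := XP x xX; have [zs bz] := XP z zX.
(* All blocks represented in [M] are merged into that of [x]. Then [y] stops being a representative
   while [x] and [z] remain: fewer blocks, but still two. *)
pose b' p := if M (b p) then x else b p.
have part_b' : module_partition c s b'.
  split=> [p ps|p ps|p q r ps qs rs].
  - by rewrite /b'; case: ifP => // _; apply: bs.
  - by rewrite /b'; case Mp: (M (b p)); rewrite ?bx ?Mx ?bK ?Mp.
  - rewrite /b'; case: ifPn => Mp; case: ifPn => Mq.
    + case: ifPn => [|Mr _ _]; first by rewrite eqxx.
      have rp : b r != b p by apply: contraNneq Mr => ->.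
      have rq : b r != b q by apply: contraNneq Mr => ->.
      by rewrite bcolor // [RHS]bcolor //; apply: modM; rewrite ?bX.
    + by move=> xq; rewrite -xq Mx in Mq.
    + by move=> px; rewrite px Mx in Mp.
    + move=> pq; case: ifPn => [Mr _|_]; last exact: bmod.
      by apply: bmod => //; apply: contraNneq Mp => <-.
have xX' : x \in undup (map b' s).
  by rewrite mem_undup; apply/mapP; exists x => //; rewrite /b' bx Mx.
have zX' : z \in undup (map b' s).
  by rewrite mem_undup; apply/mapP; exists z => //; rewrite /b' bz (negbTE Mz).
have b'_gt1 : 1 < size (undup (map b' s)).
  apply: (@uniq_leq_size _ [:: x; z]).
    by rewrite /= inE andbT; apply: contraNneq Mz => <-.
  by move=> u; rewrite !inE => /orP[] /eqP ->.
have : size (undup (map b' s)) < size X.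
  have X_gt0 : 0 < size X by apply: ltnW.
  rewrite -(prednK X_gt0) ltnS -(size_rem yX).
  apply: uniq_leq_size => [|u]; first exact: undup_uniq.
  rewrite mem_rem_uniq ?undup_uniq // mem_undup inE /= => /mapP[p ps ->].
  rewrite /b'; case: ifPn => Mp; first by rewrite xy xX.
  by rewrite bX // andbT; apply: contraNneq Mp => ->.
rewrite b_n ltnNge => /negP; apply; apply: min_n; apply/asboolP.
by exists b'.
Qed.

(** * Embeddings of labelled coloured sets *)

Definition embeds (T : eqType) (K L : Type) (c : T -> T -> K) (l : T -> L)
    (s t : seq T) : Prop :=
  exists f : T -> T, [/\ {in s, forall x, f x \in t}, {in s, forall x, l (f x) = l x} &
    {in s &, forall x y, c (f x) (f y) = c x y}].

Lemma embeds_sub (T : eqType) (K L : Type) (c : T -> T -> K) (l : T -> L)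
    (s t : seq T) : {subset s <= t} -> embeds c l s t.
Proof. by move=> st; exists id. Qed.

Lemma embeds_trans (T : eqType) (K L : Type) (c : T -> T -> K) (l : T -> L)
    (t s u : seq T) : embeds c l s t -> embeds c l t u -> embeds c l s u.
Proof.
move=> [f [fs fl fc]] [g [gs gl gc]]; exists (g \o f); split=> [x xs|x xs|x y xs ys] /=.
- exact/gs/fs.
- by rewrite gl ?fl ?fs.
- by rewrite gc ?fc ?fs.
Qed.

(** The bound ranges over all subsets of [s], so it is inherited by the blocks. *)
Definition primitives_bounded (T : eqType) (K : Type) (c : T -> T -> K) (m : nat)
    (s : seq T) : Prop :=
  uniq s /\ forall X, uniq X -> {subset X <= s} -> primitive c X -> size X <= m.

(* A single point is described by its label and its colour, a larger set by   *)
(* the colours between its blocks [B k].                                      *)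
Definition composed (T : eqType) (K L : finType) (c : T -> T -> K) (l : T -> L)
    (m : nat) (s : seq T) (key : (L * K) + {ffun 'I_m * 'I_m -> K})
    (B : nat -> seq T) : Prop :=
  (forall k, size (B k) < size s) /\
  match key with
  | inl ak => (exists2 x, s = [:: x] & (l x, c x x) = ak) /\ forall k, B k = [::]
  | inr mat => exists j : T -> 'I_m, (forall k, B k = [seq x <- s | j x == k :> nat]) /\
      {in s &, forall x y, j x != j y -> c x y = mat (j x, j y)}
  end.

Lemma composed_subset (T : eqType) (K L : finType) (c : T -> T -> K) (l : T -> L)
    (m : nat) s (key : (L * K) + {ffun 'I_m * 'I_m -> K}) B k :
  uniq s -> composed c l s key B -> uniq (B k) /\ {subset B k <= s}.
Proof.
move=> us [_]; case: key => [ak [_ ->]//|mat [j [-> _]]].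
by split=> [|x]; [rewrite filter_uniq | rewrite mem_filter => /andP[]].
Qed.

(** Embeddings of corresponding blocks glue: colours within a block are preserved by its own map,
    and colours across blocks are read off the common matrix. *)
Lemma composed_embeds (T : eqType) (K L : finType) (c : T -> T -> K) (l : T -> L)
    (m : nat) s t (key : (L * K) + {ffun 'I_m * 'I_m -> K}) B B' :
  composed c l s key B -> composed c l t key B' ->
  (forall k, k < m -> embeds c l (B k) (B' k)) -> embeds c l s t.
Proof.
move=> [_ +] [_]; case: key => [ak|mat].
  move=> [[x -> <-] _] [[y -> [ly cy]] _] _; exists (fun=> y).
  by split=> [u _|u|u v]; rewrite !inE // => /eqP-> // /eqP->.
move=> [i [Bi cs]] [j [Bj ct]] BB'.
have [f Hf] : {f & forall k, k < m ->
    [/\ {in B k, forall x, f k x \in B' k}, {in B k, forall x, l (f k x) = l x} &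
        {in B k &, forall x y, c (f k x) (f k y) = c x y}]}.
  apply: (choice (P := fun k f => k < m ->
    [/\ {in B k, forall x, f x \in B' k}, {in B k, forall x, l (f x) = l x} &
        {in B k &, forall x y, c (f x) (f y) = c x y}])) => k.
  by have [/BB'[f Hf]|_] := ltnP k m; [exists f | exists id].
have inB x : x \in s -> x \in B (i x) by rewrite Bi mem_filter eqxx.
have fB' x : x \in s -> f (i x) x \in t /\ j (f (i x) x) = i x.
  move=> xs; have [/(_ x (inB x xs)) + _ _] := Hf (i x) (ltn_ord _).
  by rewrite Bj mem_filter => /andP[/eqP/val_inj -> ->].
exists (fun x => f (i x) x); split=> [x xs|x xs|x y xs ys].
- exact: (fB' x xs).1.
- by have [_ fl _] := Hf (i x) (ltn_ord _); apply/fl/inB.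
- have [eq_xy|neq_xy] := eqVneq (i x) (i y).
    have [_ _ fc] := Hf (i y) (ltn_ord _).
    by rewrite eq_xy; apply: fc; [rewrite -eq_xy|]; apply: inB.
  have [xt jx] := fB' x xs; have [yt jy] := fB' y ys.
  by rewrite (ct _ _ xt yt) jx jy // -cs.
Qed.

Lemma primitives_bounded_composed (T : eqType) (K L : finType) (c : T -> T -> K)
    (l : T -> L) (m : nat) (s : seq T) :
  (forall x y x' y', c x y = c x' y' -> c y x = c y' x') ->
  primitives_bounded c m s -> 0 < size s ->
  exists (key : (L * K) + {ffun 'I_m * 'I_m -> K}) B, composed c l s key B.
Proof.
move=> csym [us boundX]; case: s us boundX => [//|x [_ _ _|y s us boundX _]].
  by exists (inl (l x, c x x)), (fun=> [::]); split=> //; split=> //; exists x.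
set s' := x :: y :: s in us boundX *.
have [b [part_b b_gt1 primX]] := exists_primitive_quotient csym us isT.
have bcolor := module_partition_color csym part_b; have [bs bK _] := part_b.
set X := undup (map b s') in b_gt1 primX.
have XP u : u \in X -> u \in s' /\ b u = u.
  by rewrite mem_undup => /mapP[v vs ->]; rewrite bs ?bK.
have X_le_m : size X <= m.
  by apply: boundX; rewrite ?undup_uniq // => u /XP[].
have bX u : u \in s' -> b u \in X by move=> us'; rewrite mem_undup map_f.
(* Having two blocks forces [m] to be positive, as [inord] requires. *)
case: m X_le_m boundX => [|m] X_le_m _; first by move: b_gt1; rewrite ltnNge (leq_trans X_le_m).
pose j u : 'I_m.+1 := inord (index (b u) X).
have jE u : u \in s' -> j u = index (b u) X :> nat.
  by move=> us'; rewrite inordK // (leq_trans _ X_le_m) // index_mem bX.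
pose mat := [ffun kk : 'I_m.+1 * 'I_m.+1 => c (nth x X kk.1) (nth x X kk.2)].
exists (inr mat), (fun k => [seq u <- s' | j u == k :> nat]); split=> [k|].
  rewrite size_filter -(count_predC (fun u => j u == k :> nat) s') -addn1 leq_add2l -has_count.
  (* Block [k] is proper: it misses the representative of index [k'], which differs from [k]. *)
  pose k' := if k == 0 then 1 else 0.
  have lt_k' : k' < size X by rewrite /k'; case: ifP => _ //; apply: ltnW.
  have [us' bu] := XP _ (mem_nth x lt_k'); apply/hasP; exists (nth x X k') => //=.
  by rewrite jE // bu index_uniq ?undup_uniq // /k'; case: k {k' lt_k' us' bu}.
exists j; split=> // u v us' vs' neq_j.
rewrite ffunE /= !jE // !nth_index ?bX //; apply: bcolor => //.
by apply: contraNneq neq_j => eq_b; rewrite /j eq_b.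
Qed.

Theorem wqo_primitives_bounded (T : eqType) (K L : finType) (c : T -> T -> K)
    (l : T -> L) (m : nat) :
  (forall x y x' y', c x y = c x' y' -> c y x = c y' x') ->
  wqo_on (embeds c l) (primitives_bounded c m).
Proof.
move=> csym; apply: (wqo_on_generated (sz := size) (M := m)
  (D := fun s (key : (L * K) + {ffun 'I_m * 'I_m -> K}) B => composed c l s key B)).
- by move=> t s u; apply: embeds_trans.
- by move=> s t /size0nil->; apply: embeds_sub.
- by move=> s; apply: primitives_bounded_composed.
- move=> s key B k [us boundX] comp _; have [uB sB] := composed_subset k us comp.
  split; [|by case: comp|exact: embeds_sub].
  by split=> // X uX XB; apply: boundX => // x /XB/sB.
- by move=> s t key B B'; apply: composed_embeds.
Qed.

(** * Standardization and patterns *)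

Definition rank (w : seq nat) (x : nat) : nat :=
  (count (fun y => y < x) (undup w)).+1.

Lemma ltn_rank (w : seq nat) : {in w &, {mono rank w : x y / x < y}}.
Proof.
move=> x y xw yw; rewrite /rank ltnS; case: (ltnP x y) => [lt_xy|le_yx]; last first.
  by apply/negbTE; rewrite -leqNgt; apply: sub_count => z /= /leq_trans; apply.
rewrite -addn1; have {1}<- : count_mem x (undup w) = 1.
  by rewrite count_uniq_mem ?undup_uniq // mem_undup xw.
rewrite -count_predUI (@eq_count _ (predI _ _) pred0) => [|z /=]; last first.
  by apply/negbTE/negP => /andP[lt_zx /eqP eq_zx]; rewrite eq_zx ltnn in lt_zx.
rewrite count_pred0 addn0; apply: sub_count => z /= /orP[lt_zx|/eqP-> //].
exact: ltn_trans lt_xy.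
Qed.

Lemma size_standardization (w : seq nat) : size (standardization w) = size w.
Proof. exact: size_map. Qed.

Lemma nth_standardization (w : seq nat) (i : nat) :
  i < size w -> nth 0 (standardization w) i = rank w (nth 0 w i).
Proof. exact: nth_map. Qed.

Lemma ltn_nth_standardization (w : seq nat) (i j : nat) :
  i < size w -> j < size w ->
  (nth 0 (standardization w) i < nth 0 (standardization w) j)
    = (nth 0 w i < nth 0 w j).
Proof. by move=> iw jw; rewrite !nth_standardization // ltn_rank ?mem_nth. Qed.

(** The ranks of the distinct letters are distinct and at most their number, so they fill an initial
    segment. *)
Lemma cayley_standardization (w : seq nat) : cayley (standardization w).
Proof.
exists (size (undup w)); first by rewrite size_standardization size_undup.
pose r := map (rank w) (undup w).
have ur : uniq r.
  rewrite map_inj_in_uniq ?undup_uniq // => x y; rewrite !mem_undup => xw yw eq_r.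
  by case: (ltngtP x y) => // lt_xy; move: lt_xy;
    rewrite -(ltn_rank (w := w)) // eq_r ltnn.
have rsub : {subset r <= iota 1 (size (undup w))}.
  move=> _ /mapP[x xw ->]; rewrite mem_iota add1n /= ltnS /rank.
  rewrite ltn_neqAle count_size andbT -all_count.
  by apply/negP => /allP/(_ x xw); rewrite ltnn.
have [_ rE] := uniq_min_size ur rsub (eq_leq (etrans (size_iota _ _) (esym (size_map _ _)))).
move=> x; transitivity (x \in r); last by rewrite rE mem_iota add1n ltnS.
by apply/mapP/mapP => -[y yw ->]; exists y; rewrite ?mem_undup // -mem_undup.
Qed.

(** Induction on the letter of [u]: if it exceeds 1, its predecessor occurs in [u], and passing from
    there to [i] raises the letter of [v] by at least 1. *)
Lemma cayley_nth_le (u v : seq nat) :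
  cayley u -> cayley v -> size u = size v ->
  (forall i j, i < size u -> j < size u -> nth 0 u i < nth 0 u j -> nth 0 v i < nth 0 v j) ->
  forall i, i < size u -> nth 0 u i <= nth 0 v i.
Proof.
move=> [m _ uP] [m' _ vP] eq_sz uv i.
have [n] := ubnP (nth 0 u i); elim: n i => // n IH i; rewrite ltnS => le_n iu.
have := uP (nth 0 u i); rewrite mem_nth // => /esym/andP[_ le_m].
have := vP (nth 0 v i); rewrite mem_nth -?eq_sz // => /esym/andP[v_gt0 _].
have [le1|gt1] := leqP (nth 0 u i) 1; first exact: leq_trans v_gt0.
have u' : (nth 0 u i).-1 \in u by rewrite uP; lia.
have ju : index (nth 0 u i).-1 u < size u by rewrite index_mem.
have := IH _ _ ju; have := uv _ i ju iu; rewrite nth_index //; lia.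
Qed.

Lemma standardization_eq (u w : seq nat) :
  cayley u -> size u = size w ->
  (forall i j, i < size u -> j < size u -> (nth 0 u i < nth 0 u j) = (nth 0 w i < nth 0 w j)) ->
  standardization w = u.
Proof.
move=> cu eq_sz uw; have cw := cayley_standardization w.
have eq_st : size (standardization w) = size u by rewrite size_standardization.
apply: (@eq_from_nth _ 0) => // i; rewrite eq_st => iu.
apply/eqP; rewrite eqn_leq; apply/andP; split.
  apply: cayley_nth_le; rewrite ?eq_st // => k j ku ju.
  by rewrite ltn_nth_standardization -?eq_sz // uw.
apply: cayley_nth_le => // k j ku ju.
by rewrite ltn_nth_standardization -?eq_sz // uw.
Qed.

Lemma pattern_le_embedding (u w : seq nat) (g : nat -> nat) :
  cayley u -> (forall i, i < size u -> g i < size w) ->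
  (forall i j, i < j -> j < size u -> g i < g j) ->
  (forall i j, i < size u -> j < size u ->
    (nth 0 u i < nth 0 u j) = (nth 0 w (g i) < nth 0 w (g j))) ->
  pattern_le u w.
Proof.
move=> cu gw g_lt uw; pose ks := mkseq g (size u).
have ks_sorted : sorted ltn ks.
  apply/(sortedP 0) => i; rewrite size_mkseq => lt_i.
  by rewrite /ks /= !nth_mkseq ?(ltnW lt_i) //; apply: g_lt.
exists (map (nth 0 w) ks).
  rewrite -{2}(mkseq_nth 0 w); apply: map_subseq.
  (* A strictly increasing list of positions is determined by its members. *)
  suff -> : ks = filter [in ks] (iota 0 (size w)) by apply: filter_subseq.
  apply: (irr_sorted_eq ltn_trans ltnn) => //.
    exact: (sorted_filter ltn_trans) (iota_ltn_sorted _ _).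
  move=> k; rewrite mem_filter mem_iota /= andb_idr // => /mapP[i].
  by rewrite mem_iota => iu ->; apply: gw.
apply: standardization_eq => //; first by rewrite size_map size_mkseq.
have ksE k : k < size u -> nth 0 (map (nth 0 w) ks) k = nth 0 w (g k).
  by move=> ku; rewrite (nth_map 0) ?size_mkseq // nth_mkseq.
by move=> i j iu ju; rewrite !ksE // uw.
Qed.

(** * From words to labelled points *)

(* A position, a letter, and the comparisons of this letter with a deleted one. *)
Definition point : Type := (nat * nat) * (bool * bool).

(** Keeping both strict comparisons also records equality of letters. *)
Definition color (p q : point) : (bool * bool) * (bool * bool) :=
  ((p.1.1 < q.1.1, q.1.1 < p.1.1), (p.1.2 < q.1.2, q.1.2 < p.1.2)).

Lemma color_sym (p q p' q' : point) : color p q = color p' q' -> color q p = color q' p'.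
Proof. by move=> [*]; congr ((_, _), (_, _)). Qed.

(* The labels allow to recover the word [a :: w]. *)
Definition labelled_points (a : nat) (w : seq nat) : seq point :=
  [seq ((i, nth 0 w i), (a < nth 0 w i, nth 0 w i < a)) | i <- iota 0 (size w)].

Lemma labelled_pointsP (a : nat) (w : seq nat) (p : point) :
  p \in labelled_points a w ->
  [/\ p.1.1 < size w, p.1.2 = nth 0 w p.1.1 & p.2 = (a < p.1.2, p.1.2 < a)].
Proof. by case/mapP => i; rewrite mem_iota => iw ->. Qed.

Lemma embeds_pattern_le (a b : nat) (u v : seq nat) :
  cayley (a :: u) ->
  embeds color snd (labelled_points a u) (labelled_points b v) ->
  pattern_le (a :: u) (b :: v).
Proof.
move=> cu [f [fs fl fc]].
pose pt i : point := ((i, nth 0 u i), (a < nth 0 u i, nth 0 u i < a)).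
have ptu i : i < size u -> pt i \in labelled_points a u.
  by move=> iu; apply/mapP; exists i => //; rewrite mem_iota.
have fP i : i < size u -> [/\ (f (pt i)).1.1 < size v,
    (f (pt i)).1.2 = nth 0 v (f (pt i)).1.1,
    (b < (f (pt i)).1.2) = (a < nth 0 u i) &
    ((f (pt i)).1.2 < b) = (nth 0 u i < a)].
  move=> iu; have [? ? Hl] := labelled_pointsP (fs _ (ptu i iu)); split=> //.
    by have := fl _ (ptu i iu); rewrite Hl => -[].
  by have := fl _ (ptu i iu); rewrite Hl => -[].
(* The first letters correspond and other positions shift by one; comparisons with the first letter
   are read off the labels. *)
apply: (@pattern_le_embedding _ _ (fun i => if i is i'.+1 then (f (pt i')).1.1.+1 else 0)).
- exact: cu.
- by case=> // i /=; rewrite !ltnS => iu; have [] := fP i iu.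
- move=> [|i] [|j] //=; rewrite !ltnS => lt_ij ju.
  have [-> _ _ _] := fc _ _ (ptu i (ltn_trans lt_ij ju)) (ptu j ju).
  exact: lt_ij.
- move=> [|i] [|j] /=; rewrite ?ltnS ?ltnn // => iu ju.
  + by have [_ <- ->] := fP j ju.
  + by have [_ <- _ ->] := fP i iu.
  + have [_ <- _ _] := fP j ju; have [_ <- _ _] := fP i iu.
    by have [_ _ -> _] := fc _ _ (ptu i iu) (ptu j ju).
Qed.

(** A point outside an H-interval lies to one side of all its positions, and its letter lies above
    or below all its letters; so the points of an H-interval form a module. *)
Lemma primitive_simple (s : seq point) :
  sorted (fun p q => p.1.1 < q.1.1) s -> primitive color s ->
  simple (standardization [seq p.1.2 | p <- s]).
Proof.
move=> s_sorted prim_s; set w := [seq p.1.2 | p <- s].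
have szw : size w = size s by apply: size_map.
pose p0 : point := ((0, 0), (false, false)).
have us : uniq s.
  apply: (sorted_uniq _ _ s_sorted) => [p q r|p]; first exact: ltn_trans.
  exact: ltnn.
have pos_lt p q : p \in s -> q \in s -> index p s < index q s -> p.1.1 < q.1.1.
  move=> ps qs lt_pq; rewrite -(nth_index p ps) -[in ltnRHS](nth_index p qs).
  apply: (sorted_ltn_nth (leT := fun p q : point => p.1.1 < q.1.1)) => //;
    rewrite ?inE ?index_mem //.
  by move=> ? ? ?; apply: ltn_trans.
have posE p q : p \in s -> q \in s -> (p.1.1 < q.1.1) = (index p s < index q s).
  move=> ps qs; case: (ltngtP (index p s) (index q s)) => [||eq_i].
  - exact: pos_lt.
  - by move=> /(pos_lt _ _ qs ps) lt_qp; rewrite ltnNge (ltnW lt_qp).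
  - by rewrite -(nth_index p ps) eq_i nth_index // ltnn.
have valE p q : p \in s -> q \in s -> (p.1.2 < q.1.2) =
    (nth 0 (standardization w) (index p s) < nth 0 (standardization w) (index q s)).
  move=> ps qs; rewrite ltn_nth_standardization ?szw ?index_mem //.
  by rewrite !(nth_map p) ?index_mem // !nth_index.
split; first exact: cayley_standardization.
move=> a b [/andP[le_ab]]; rewrite size_standardization szw => bs [c [d [_ cd]]].
have cdE i : i < size s -> (c <= nth 0 (standardization w) i <= d) = (a <= i <= b).
  move=> i_s; apply/idP/idP => Hi.
    by have : nat_itv a b i by rewrite -cd.
  by have : nat_itv a b i by []; rewrite -cd => -[].
have [x y z xs ys zs Mx My Mz|sing|full] := prim_s (fun p => a <= index p s <= b).
- rewrite /color !posE // !valE //.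
  move: Mx My Mz; rewrite -!cdE ?index_mem // => cx cy cz.
  have := cdE _ (etrans (index_mem x s) xs); have := cdE _ (etrans (index_mem y s) ys).
  have := cdE _ (etrans (index_mem z s) zs).
  by move=> *; congr ((_, _), (_, _)); lia.
- left; have as' := leq_ltn_trans le_ab bs.
  rewrite -(index_uniq p0 as' us) -[RHS](index_uniq p0 bs us); congr index.
  by apply: sing; rewrite ?mem_nth // index_uniq // leqnn le_ab.
- right; have s_gt0 : 0 < size s by apply: leq_ltn_trans bs.
  have := full _ (mem_nth p0 s_gt0); rewrite index_uniq // => /andP[a0 _].
  have lt_s : (size s).-1 < size s by rewrite prednK.
  have := full _ (mem_nth p0 lt_s); rewrite index_uniq // => /andP[_ sb].
  by split; lia.
Qed.

(** A primitive set, read in order of position, yields a simple pattern of [w]. This is shorter than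
    [a :: w], so minimality puts it in [C]; deleting [a] is what makes it shorter. *)
Lemma basis_primitives_bounded (C : set (seq nat)) (m : nat) (a : nat) (w : seq nat) :
  (forall t, C t -> simple t -> size t <= m) -> basis C (a :: w) ->
  primitives_bounded color m (labelled_points a w).
Proof.
move=> boundC [_ _ minw].
have pos_sorted : sorted (fun p q : point => p.1.1 < q.1.1) (labelled_points a w).
  by rewrite sorted_map; apply: iota_ltn_sorted.
have uw : uniq (labelled_points a w) by rewrite map_inj_uniq ?iota_uniq // => i j [].
split=> // X uX sX primX.
pose s := filter [in X] (labelled_points a w).
have sE : s =i X by move=> p; rewrite mem_filter andb_idr // => /sX.
have -> : size X = size s.
  by apply/eqP; rewrite eq_sym -uniq_size_uniq // filter_uniq.
have prim_s : primitive color s.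
  move=> M modM.
  have [x y z xX yX zX|sing|full] := primX M.
  - by apply: modM; rewrite sE.
  - by left=> x y; rewrite !sE; apply: sing.
  - by right=> x; rewrite sE; apply: full.
have simple_s := primitive_simple
  (sorted_filter (fun _ _ _ => @ltn_trans _ _ _) _ pos_sorted) prim_s.
set t := standardization _ in simple_s.
have szt : size t = size s by rewrite size_standardization size_map.
rewrite -szt; apply: boundC => //; apply: contrapT => nCt.
have ltw : pattern_le t (a :: w).
  exists [seq p.1.2 | p <- s] => //; apply: subseq_trans (subseq_cons w a).
  have wE : w = [seq p.1.2 | p <- labelled_points a w].
    by rewrite -map_comp -[LHS](mkseq_nth 0).
  rewrite [X in subseq _ X]wE.
  exact/map_subseq/filter_subseq.
have := congr1 size (minw t (simple_s.1) nCt ltw); rewrite szt => /= eq_sz.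
have := count_size [in X] (labelled_points a w).
by rewrite -size_filter -/s eq_sz size_map size_iota ltnn.
Qed.

Lemma basis_nil (C : set (seq nat)) (w : seq nat) : basis C [::] -> basis C w -> w = [::].
Proof.
move=> [c0 nC0 _] [_ _ minw]; apply/esym/minw => //.
by exists [::]; rewrite ?sub0seq.
Qed.

Theorem theorem7p12 (C : set (seq nat)) :
  cayley_class C -> finite_set (C `&` simple) -> finite_set (basis C).
Proof.
move=> _ /finite_seqP[l lE]; apply: contrapT => /infiniteP/card_leP[g].
pose beta i := val (g (to_setT i)).
have Bbeta i : basis C (beta i) by apply: set_valP.
have beta_inj i j : beta i = beta j -> i = j.
  move=> /val_inj/(inj (f := g)) eq_ij.
  by have := congr1 val (eq_ij _ _); rewrite ?inE; apply.
have boundC t : C t -> simple t -> size t <= \max_(u <- l) size u.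
  move=> Ct St; apply: leq_bigmax_seq => //.
  by have : (C `&` simple) t by []; rewrite lE.
(* The empty word is a pattern of every word, so a basis containing it has no other element. *)
have cons_beta i : beta i = head 0 (beta i) :: behead (beta i).
  case E: (beta i) => [|//]; have B0 := Bbeta i; rewrite E in B0.
  have := beta_inj i i.+1; rewrite E (basis_nil B0 (Bbeta i.+1)) => /(_ erefl).
  by move/n_Sn.
have [|i [j [lt_ij]]] := @wqo_primitives_bounded point _ _ color snd
  (\max_(u <- l) size u) color_sym
  (fun i => labelled_points (head 0 (beta i)) (behead (beta i))).
  by move=> i; apply: basis_primitives_bounded boundC _; rewrite -cons_beta.
have [ci nCi _] := Bbeta i; have [_ _ minj] := Bbeta j.
move/embeds_pattern_le; rewrite -!cons_beta => /(_ ci) le_ij.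
by move: lt_ij; rewrite (beta_inj _ _ (minj _ ci nCi le_ij)) ltnn.
Qed.
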